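(* Let $0\le q_1,q_2\le 1/2$. The capacity region of the binary doubly-dirty multiple access channel $Y=X_1\oplus X_2\oplus S_1\oplus S_2$ with input constraints $q_1,q_2$ is the set $$\mathcal{C}(q_1,q_2)=\Big\{(R_1,R_2):\ R_1,R_2\ge 0,\ R_1+R_2\le \min\{H_b(q_1),H_b(q_2)\}\Big\}.$$
   Context: Notation: $\oplus$ is addition mod 2 (componentwise on vectors), $w_H(\cdot)$ is Hamming weight, $\log=\log_2$, and $H_b(x)=-x\log_2 x-(1-x)\log_2(1-x)$ is the binary entropy function (with $H_b(0)=H_b(1)=0$). Channel: the binary doubly-dirty MAC has two users with inputs $X_1,X_2\in\{0,1\}$ and output $Y=X_1\oplus X_2\oplus S_1\oplus S_2$. The interference sequences $\mathbf{s}_1,\mathbf{s}_2\in\{0,1\}^n$ have i.i.d. Bernoulli$(1/2)$ entries, and are independent of each other and of the messages. User $i$ knows the whole sequence $\mathbf{s}_i$ in advance (non-causally) but not the other user's interference; the receiver knows neither. Code: a code of block length $n$ consists of message sets $\mathcal{W}_1,\mathcal{W}_2$, encoders $\mathbf{x}_i=\phi_i(W_i,\mathbf{s}_i)\in\{0,1\}^n$ satisfying $\frac1n w_H(\mathbf{x}_i)\le q_i$ for $i=1,2$, and a decoder producing $(\hat W_1,\hat W_2)$ from $\mathbf{y}=\mathbf{x}_1\oplus\mathbf{x}_2\oplus\mathbf{s}_1\oplus\mathbf{s}_2$. The rates are $R_i=\frac1n\log|\mathcal{W}_i|$. The error probability is $\Pr\{(\hat W_1,\hat W_2)\ne(W_1,W_2)\}$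 where $W_1,W_2$ are independent and uniform on their message sets. A pair $(R_1,R_2)$ of nonnegative reals is achievable if there is a sequence of codes, with $n\to\infty$, whose rates converge to $(R_1,R_2)$ and whose error probability tends to $0$. The capacity region is the closure of the set of achievable pairs. *)

(* Defs.v *)
From HB Require Import structures.
From mathcomp Require Import all_boot all_order all_algebra.
From mathcomp Require Import all_classical all_reals all_analysis.
Set Implicit Arguments.
Unset Strict Implicit.
Unset Printing Implicit Defensive.
Import Order.TTheory GRing.Theory Num.Theory numFieldNormedType.Exports.
Local Open Scope classical_set_scope.
Local Open Scope ring_scope.

Definition log2 (R : realType) (x : R) : R := ln x / ln 2.

(* ln 0 = 0 in the library, so the formula gives Hb 0 = Hb 1 = 0. *)
Definition Hb (R : realType) (x : R) : R :=
  - x * log2 x - (1 - x) * log2 (1 - x).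

(* Binary words are row vectors over 'F_2: their sum is the componentwise
   addition mod 2. *)
Definition wH (n : nat) (x : 'rV['F_2]_n) : nat := #|[pred i | x 0 i != 0]|.

(* Binary doubly-dirty MAC, with n uses of Y = X1 + X2 + S1 + S2. *)
Definition ddmac (n : nat) (x1 x2 s1 s2 : 'rV['F_2]_n) : 'rV['F_2]_n :=
  x1 + x2 + s1 + s2.

(* Law of a word with i.i.d. Bernoulli(1/2) entries. *)
Definition interference_pmf (R : realType) (n : nat) (s : 'rV['F_2]_n) : R :=
  \prod_(i < n) bernoulli_pmf 2^-1 (s 0 i == 1).

(* The second argument of an encoder is the user's whole interference word
   (non-causal knowledge).  The message sets are nonempty, so that rates and
   the uniform law make sense. *)
Record code (R : realType) (q1 q2 : R) (n : nat) := Code {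
  msg1 : finType;
  msg2 : finType;
  msg1_gt0 : (0 < #|msg1|)%N;
  msg2_gt0 : (0 < #|msg2|)%N;
  enc1 : msg1 -> 'rV['F_2]_n -> 'rV['F_2]_n;
  enc2 : msg2 -> 'rV['F_2]_n -> 'rV['F_2]_n;
  dec : 'rV['F_2]_n -> msg1 * msg2;
  enc1_weight : forall w s, (wH (enc1 w s))%:R / n%:R <= q1;
  enc2_weight : forall w s, (wH (enc2 w s))%:R / n%:R <= q2
}.

Definition rate1 (R : realType) (q1 q2 : R) (n : nat) (C : code q1 q2 n) : R :=
  log2 #|msg1 C|%:R / n%:R.

Definition rate2 (R : realType) (q1 q2 : R) (n : nat) (C : code q1 q2 n) : R :=
  log2 #|msg2 C|%:R / n%:R.

(* Probability of decoding error under the product law of (W1, W2, S1, S2),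
   with W1, W2 uniform. *)
Definition error_prob (R : realType) (q1 q2 : R) (n : nat)
    (C : code q1 q2 n) : R :=
  \sum_(w1 : msg1 C) \sum_(w2 : msg2 C)
  \sum_(s1 : 'rV['F_2]_n) \sum_(s2 : 'rV['F_2]_n
      | dec C (ddmac (enc1 w1 s1) (enc2 w2 s2) s1 s2) != (w1, w2))
    #|msg1 C|%:R^-1 * #|msg2 C|%:R^-1 *
    interference_pmf R s1 * interference_pmf R s2.

Definition achievable (R : realType) (q1 q2 : R) : set (R * R) :=
  [set r : R * R | [/\ 0 <= r.1, 0 <= r.2 &
    exists (n : nat -> nat) (C : forall k, code q1 q2 (n k)),
      [/\ n k @[k --> \oo] --> \oo,
          rate1 (C k) @[k --> \oo] --> r.1,
          rate2 (C k) @[k --> \oo] --> r.2 &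
          error_prob (C k) @[k --> \oo] --> (0 : R)]]].

Definition capacity_region (R : realType) (q1 q2 : R) : set (R * R) :=
  closure (achievable q1 q2).

(* Main.v *)
Require Import Defs.
From HB Require Import structures.
From mathcomp Require Import all_boot all_order all_algebra.
From mathcomp Require Import all_classical all_reals all_analysis.
From mathcomp Require Import ring lra.
Import Order.TTheory GRing.Theory Num.Theory numFieldNormedType.Exports.
Local Open Scope ring_scope.

(* Converse: given both messages and the other user's interference, the output
   y determines s_i up to the choice of x_i in the Hamming ball B of radius
   n q_i, so at most |B| values of s_i lead to a given y.  Counting the correctly
   decoded tuples gives |W1| |W2| (1 - P_err) <= |B| <= 2 ^ (n Hb(q_i)).

   Achievability, with zero error: let q = min(q1, q2) and suppose that a linear
   code with onto parity check H : F_2^n -> F_2^m covers F_2^n by balls of radius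
   n q.  User 1 picks x1 in the ball so that x1 + s1 has syndrome (w1, 0), user 2
   picks x2 so that x2 + s2 has syndrome (0, w2), and the receiver reads (w1, w2)
   off the syndrome of y; every split of the m bits between the users is allowed.
   Goblick's doubling argument yields such a code as soon as n 2^m <= |B|: by
   averaging, some x makes the span of C and x leave uncovered at most the square
   of the fraction that C leaves uncovered.  Finally
   |B| >= (q / (2 (n + 1))) 2 ^ (n Hb(q)). *)

(** * Size of Hamming balls *)

Lemma F2_neq0E (b : 'F_2) : b = (b != 0)%:R.
Proof. by apply: val_inj; case: b => [[|[|k]] lt_k2]. Qed.

Lemma card_rVF2 (n : nat) : #|{: 'rV['F_2]_n}| = (2 ^ n)%N.
Proof. by rewrite card_mx card_Fp ?mul1n. Qed.

Lemma card_wH_eq (n j : nat) : #|[set x : 'rV['F_2]_n | wH x == j]| = 'C(n, j).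
Proof.
pose f (A : {set 'I_n}) : 'rV['F_2]_n := \row_i (i \in A)%:R.
have fE A i : (f A 0 i != 0) = (i \in A) by rewrite mxE; case: (i \in A).
have wHf A : wH (f A) = #|A| by apply: eq_card => i; rewrite inE fE.
have f_inj : injective f by move=> A B eqf; apply/setP=> i; rewrite -!fE eqf.
rewrite -[X in 'C(X, _)](card_ord n) -card_draws -(card_imset _ f_inj).
apply: eq_card => x; rewrite inE; apply/idP/imsetP => [wx|[A]]; last first.
  by rewrite inE => cA ->; rewrite wHf.
have xE : x = f [set i | x 0 i != 0].
  by apply/rowP=> i; rewrite mxE inE {1}[x 0 i]F2_neq0E.
by exists [set i | x 0 i != 0] => //; rewrite inE -wHf -xE.
Qed.

Definition wball (R : realType) (q : R) (n : nat) : {set 'rV['F_2]_n} :=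
  [set x : 'rV['F_2]_n | (wH x)%:R <= n%:R * q].

Arguments wball {R}.

Lemma ln2_gt0 (R : realType) : 0 < ln 2 :> R.
Proof. by rewrite ln_gt0 // ltr1n. Qed.

Lemma ln2_Hb (R : realType) (q : R) :
  ln 2 * Hb q = - (q * ln q + (1 - q) * ln (1 - q)).
Proof. by rewrite /Hb /log2; field; rewrite gt_eqF // ln2_gt0. Qed.

Lemma wH_le (n : nat) (x : 'rV['F_2]_n) : (wH x <= n)%N.
Proof. by rewrite -[X in (_ <= X)%N]card_ord max_card. Qed.

Lemma sum_wH (V : nmodType) (n : nat) (F : nat -> V) :
  \sum_(x : 'rV['F_2]_n) F (wH x) = \sum_(j < n.+1) F j *+ 'C(n, j).
Proof.
pose w x : 'I_n.+1 := inord (@wH n x).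
have wE x : w x = wH x :> nat by rewrite inordK // ltnS wH_le.
rewrite (partition_big w predT) //=; apply: eq_bigr => j _.
rewrite -card_wH_eq -sumr_const; apply: eq_big => [x|x /eqP <-]; last by rewrite wE.
by rewrite inE -wE.
Qed.

Section BallSize.
Variables (R : realType) (q : R) (n : nat).
Hypotheses (q_gt0 : 0 < q) (q_le : q <= 2^-1).

Let p_gt0 : 0 < 1 - q. Proof. by move: q_le => ?; lra. Qed.
(** The probability of one word of weight [j] under i.i.d. Bernoulli(q) letters. *)
Let term j : R := q ^+ j * (1 - q) ^+ (n - j).

Let sum_term : \sum_(j < n.+1) term j *+ 'C(n, j) = 1.
Proof.
rewrite -[RHS](expr1n _ n) -[1 in RHS](subrK q) exprDn.
by apply: eq_bigr => j _; rewrite mulrC.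
Qed.

(** Centring the exponent at j = n q isolates 2^(-n Hb(q)) times a tilt that is at least 1 for j <=
    n q, because q <= 1/2. *)
Let termE j : (j <= n)%N ->
  term j = expR (- (n%:R * (ln 2 * Hb q)) + (n%:R * q - j%:R) * (ln (1 - q) - ln q)).
Proof.
move=> le_jn; rewrite /term -{1}(@lnK _ q) // -{1}(@lnK _ (1 - q)) // -!expRM_natl -expRD.
by congr expR; rewrite natrB // ln2_Hb; ring.
Qed.

(** Every word of the ball has probability at least 2^(-n Hb(q)), and the total is 1. *)
Lemma card_wball_le_gt0 : #|wball q n|%:R <= expR (n%:R * (ln 2 * Hb q)).
Proof.
have q_le2 := q_le.
have ln_le : ln q <= ln (1 - q) by rewrite ler_ln ?posrE //; lra.
rewrite -[leRHS]mulr1 -ler_pdivrMl ?expR_gt0 // -expRN mulrC -sum1_card natr_sum.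
rewrite mulr_suml -[leRHS]sum_term -sum_wH big_mkcond /=.
apply: ler_sum => x _; rewrite /wball inE mul1r.
case: ifP => [wx|_]; last by rewrite mulr_ge0 // exprn_ge0 // ltW.
by rewrite termE ?wH_le // ler_expR lerDl mulr_ge0 // ?subr_ge0.
Qed.

(* The binomial term of index t = floor(n q) is within a factor 2 of the largest
   of the n + 1 terms, which sum to 1. *)
Lemma card_wball_ge_gt0 :
  q * expR (n%:R * (ln 2 * Hb q)) <= 2 * n.+1%:R * #|wball q n|%:R.
Proof.
have q0 := q_gt0; have q_le2 := q_le.
have q1 : q <= 1 by lra.
have nq0 : 0 <= n%:R * q by rewrite mulr_ge0 // ltW.
pose t := Num.truncn (n%:R * q).
have /andP[t_le t_gt] : t%:R <= n%:R * q < t.+1%:R by apply: truncn_itv.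
have le_tn : (t <= n)%N.
  by rewrite -(ler_nat R) (le_trans t_le) // ler_piMr.
pose f j : R := term j *+ 'C(n, j).
have f_ge0 j : 0 <= f j by rewrite mulrn_wge0 // mulr_ge0 // exprn_ge0 // ltW.
have fE j : f j = q ^+ j * (1 - q) ^+ (n - j) * 'C(n, j)%:R.
  by rewrite /f mulr_natr.
(* Ratio of consecutive binomial terms, cleared of denominators. *)
have fS j : (j < n)%N -> (j.+1%:R * (1 - q)) * f j.+1 = ((n - j)%:R * q) * f j.
  move=> lt_jn; rewrite !fE.
  have -> : (n - j = (n - j.+1).+1)%N by rewrite subnSK.
  have /(congr1 (fun k => k%:R : R)) := mul_bin_left n j.
  rewrite -(subnSK lt_jn) !natrM !exprS => E.
  transitivity (q * q ^+ j * (1 - q) * (1 - q) ^+ (n - j.+1) *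
                (j.+1%:R * 'C(n, j.+1)%:R)).
    by ring.
  by rewrite E; ring.
have f_le2 j : (j <= n)%N -> f j <= 2 * f t.
  move=> le_jn; case: (leqP j t) => [le_jt|lt_tj].
    suff : f j <= f t by move: (f_ge0 t); lra.
    pose d := (t - j)%N; have := erefl d; rewrite {1}/d.
    move: d => d; elim: d j le_jt {le_jn} => [|d IHd] j le_jt dE.
      by rewrite (_ : j = t) //; apply/eqP; rewrite eqn_leq le_jt -subn_eq0 dE.
    have lt_jt : (j < t)%N by rewrite -subn_gt0 dE.
    apply: le_trans (IHd j.+1 lt_jt _); last by rewrite subnS dE.
    have lt_jn := leq_trans lt_jt le_tn.
    have c_gt0 : 0 < j.+1%:R * (1 - q) by rewrite mulr_gt0.
    rewrite -(ler_pM2l c_gt0) fS // ler_wpM2r // natrB ?(ltnW lt_jn) //.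
    have : j.+1%:R <= t%:R :> R by rewrite ler_nat.
    by rewrite -natr1; lra.
  (* The terms do not decrease up to [t] nor increase after [t.+1]. The step between may go either
     way, but (n - t) q < t + 1 and 1 - q >= 1/2 keep its ratio at most 2. *)
  have ft1 : f t.+1 <= 2 * f t.
    have lt_tn := leq_trans lt_tj le_jn.
    have c_gt0 : 0 < t.+1%:R * (1 - q) by rewrite mulr_gt0.
    rewrite -(ler_pM2l c_gt0) fS // mulrA ler_wpM2r // natrB ?(ltnW lt_tn) //.
    have t0 : 0 <= t%:R * q by rewrite mulr_ge0 // ltW.
    have h : t.+1%:R * 2^-1 <= t.+1%:R * (1 - q) by rewrite ler_wpM2l //; lra.
    by lra.
  apply: le_trans ft1.
  elim: j lt_tj le_jn => // j IHj; rewrite ltnS leq_eqVlt => /predU1P[<- //|lt_tj] lt_jn.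
  apply: le_trans (IHj lt_tj (ltnW lt_jn)).
  have c_gt0 : 0 < j.+1%:R * (1 - q) by rewrite mulr_gt0.
  rewrite -(ler_pM2l c_gt0) fS // ler_wpM2r // natrB ?(ltnW lt_jn) //.
  have : t.+1%:R <= j%:R :> R by rewrite ler_nat.
  by rewrite -natr1; lra.
have sum_le : 1 <= n.+1%:R * (2 * f t).
  rewrite -[leLHS]sum_term mulr_natl -[X in _ *+ X]card_ord -sumr_const.
  by apply: ler_sum => j _; apply: f_le2; rewrite -ltnS.
have C_le : 'C(n, t)%:R <= #|wball q n|%:R :> R.
  rewrite ler_nat -card_wH_eq subset_leq_card //; apply/fintype.subsetP => x.
  by rewrite !inE => /eqP ->.
(* As n q - t < 1, the tilt at [t] is at most (1 - q) / q; the factor [q] in the bound pays for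
   it. *)
have ft_le : q * expR (n%:R * (ln 2 * Hb q)) * f t <= 'C(n, t)%:R.
  rewrite /f -[term t *+ _]mulr_natr mulrA ler_piMl // termE //.
  rewrite -mulrA -expRD addrA subrr add0r.
  have : expR ((n%:R * q - t%:R) * (ln (1 - q) - ln q)) <= expR (ln (1 - q) - ln q).
    rewrite ler_expR ler_piMl //; last by rewrite -natr1 in t_gt; lra.
    by rewrite subr_ge0 ler_ln ?posrE //; lra.
  rewrite expRB !lnK ?posrE // ler_pdivlMr // mulrC => /le_trans; apply.
  by lra.
have e0 : 0 <= q * expR (n%:R * (ln 2 * Hb q)) by rewrite mulr_ge0 ?expR_ge0 // ltW.
apply: le_trans (ler_peMr e0 sum_le) _.
rewrite [leLHS](_ : _ = 2 * n.+1%:R * (q * expR (n%:R * (ln 2 * Hb q)) * f t));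
  last by ring.
by apply: ler_wpM2l; [rewrite mulr_ge0 | exact: le_trans ft_le C_le].
Qed.

End BallSize.

Lemma card_wball_le (R : realType) (q : R) (n : nat) :
  0 <= q <= 2^-1 -> #|wball q n|%:R <= expR (n%:R * (ln 2 * Hb q)).
Proof.
rewrite le_eqVlt => /andP[/predU1P[<- _|q_gt0 q_le]]; last exact: card_wball_le_gt0.
(* At q = 0 the exponent vanishes and the ball reduces to the zero word. *)
rewrite ln2_Hb mul0r add0r subr0 ln1 mulr0 oppr0 mulr0 expR0 (@ler_nat _ _ 1).
rewrite -[leqRHS](bin0 n) -card_wH_eq subset_leq_card //; apply/fintype.subsetP => x.
by rewrite !inE mulr0 lern0.
Qed.

(** * Linear covering codes *)

Section Covering.
Variables (n : nat) (B : {set 'rV['F_2]_n}).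

(** The code is the row space of [G], whose rows may be dependent, so that any word can be appended
    as a new row. *)
Definition uncovered (k : nat) (G : 'M['F_2]_(k, n)) : {set 'rV['F_2]_n} :=
  [set z | [forall u : 'rV['F_2]_k, z - u *m G \notin B]].

(** The new row has coefficient 0 or 1, so the enlarged code is the old one together with its
    translate by [x]. *)
Lemma uncovered_col_mx (k : nat) (x : 'rV['F_2]_n) (G : 'M['F_2]_(k, n)) z :
  (z \in uncovered (1 + k) (col_mx x G)) =
  (z \in uncovered k G) && (z - x \in uncovered k G).
Proof.
rewrite !inE; apply/forallP/andP => [zU|[/forallP zU /forallP zxU] u].
  split; apply/forallP=> u.
    by have := zU (row_mx 0 u); rewrite mul_row_col mul0mx add0r.
  by have := zU (row_mx 1 u); rewrite mul_row_col mul1mx opprD addrA.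
rewrite -(hsubmxK u) mul_row_col (mx11_scalar (lsubmx u)) mul_scalar_mx.
rewrite [lsubmx u 0 0]F2_neq0E; case: (_ != 0); rewrite ?scale1r ?scale0r.
  by rewrite opprD addrA.
by rewrite add0r.
Qed.

(* Averaged over x, the words left uncovered by both the span of G and its
   translate by x form the square of the uncovered fraction. *)
Lemma exists_uncovered_step (k : nat) (G : 'M['F_2]_(k, n)) :
  exists x : 'rV['F_2]_n,
    (#|uncovered (1 + k) (col_mx x G)| * 2 ^ n <= #|uncovered k G| ^ 2)%N.
Proof.
set U := uncovered k G.
have sumE : (\sum_(x : 'rV['F_2]_n) #|uncovered (1 + k) (col_mx x G)| = #|U| ^ 2)%N.
  transitivity (\sum_(x : 'rV['F_2]_n) \sum_(z in U) (z - x \in U)%R)%N.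
    apply: eq_bigr => x _; rewrite -sum1_card big_mkcond [RHS]big_mkcond /=.
    apply: eq_bigr => z _; rewrite uncovered_col_mx -/U.
    by case: (z \in U); case: (z - x \in U).
  rewrite exchange_big /= -mulnn -sum_nat_const; apply: eq_bigr => z _.
  (* For fixed [z], x -> z - x is an involution, so the inner sum is the size of [U]. *)
  rewrite (reindex_inj (inv_inj (subKr z))) /= -sum1_card [RHS]big_mkcond /=.
  by apply: eq_bigr => x _; rewrite subKr; case: (x \in U).
apply/existsP; apply: contraT; rewrite negb_exists => /forallP lt_all.
have : (\sum_(x : 'rV['F_2]_n) #|U| ^ 2 <
        \sum_(x : 'rV['F_2]_n) #|uncovered (1 + k) (col_mx x G)| * 2 ^ n)%N.
  rewrite ltn_neqAle; apply/andP; split; last first.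
    by apply: leq_sum => x _; rewrite ltnW // ltnNge lt_all.
  rewrite (bigD1 0) //= [X in (_ != X)%N](bigD1 0) //= neq_ltn; apply/orP; left.
  rewrite -addSn leq_add //; first by rewrite ltnNge lt_all.
  by apply: leq_sum => x _; rewrite ltnW // ltnNge lt_all.
by rewrite sum_nat_const card_rVF2 -big_distrl /= sumE mulnC ltnn.
Qed.

(** The recursion starts at the code {0}, which leaves uncovered at most the complement of [B]; each
    new generator squares the bound on the uncovered fraction. *)
Lemma exists_uncovered_le (R : realFieldType) (k : nat) :
  exists G : 'M['F_2]_(k, n),
    #|uncovered k G|%:R / 2 ^+ n <= (1 - #|B|%:R / 2 ^+ n) ^+ (2 ^ k) :> R.
Proof.
have N_gt0 : 0 < 2 ^+ n :> R by rewrite exprn_gt0.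
elim: k => [|k [G le_G]].
  exists 0; rewrite expn0 expr1 ler_pdivrMr // mulrBl mul1r divfK ?gt_eqF //.
  rewrite lerBrDl -natrD -natrX ler_nat.
  rewrite -card_rVF2 -(cardsC B) leq_add2l; apply: subset_leq_card.
  apply/fintype.subsetP => z; rewrite !inE => /forallP/(_ 0).
  by rewrite mul0mx subr0.
have [x le_x] := exists_uncovered_step k G.
exists (col_mx x G); rewrite expnS mulnC exprM.
apply: le_trans (_ : (#|uncovered k G|%:R / 2 ^+ n) ^+ 2 <= _).
  rewrite expr_div_n ler_pdivlMr ?exprn_gt0 // expr2 mulrA divfK ?gt_eqF //.
  by rewrite -!natrX -natrM ler_nat.
by rewrite lerXn2r // ?nnegrE ?(le_trans _ le_G) // divr_ge0 // ltW.
Qed.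

(** With b = |B| / 2^n, (1 - b)^(2^k) <= e^(-b 2^k) <= e^(-n) < 2^(-n): less than one word stays
    uncovered. *)
Lemma exists_covering_code (R : realType) (k : nat) :
  (0 < n)%N -> (n * 2 ^ n <= #|B| * 2 ^ k)%N ->
  exists G : 'M['F_2]_(k, n), forall z, exists u, z - u *m G \in B.
Proof.
move=> n_gt0 le_nB; have [G le_G] := exists_uncovered_le R k.
exists G => z; apply/existsP; apply: contraT; rewrite negb_exists => zU.
have U_gt0 : (0 < #|uncovered k G|)%N by apply/card_gt0P; exists z; rewrite inE.
have N_gt0 : 0 < 2 ^+ n :> R by rewrite exprn_gt0.
have N_le : (2 ^+ n)^-1 <= (1 - #|B|%:R / 2 ^+ n) ^+ (2 ^ k) :> R.
  by apply: le_trans le_G; rewrite ler_peMl ?invr_ge0 ?(ltW N_gt0) // ler1n.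
have B_le1 : #|B|%:R / 2 ^+ n <= 1 :> R.
  rewrite ler_pdivrMr // mul1r -natrX ler_nat (leq_trans (max_card _)) //.
  by rewrite card_rVF2.
have : (1 - #|B|%:R / 2 ^+ n) ^+ (2 ^ k) <= expR (- 1) ^+ n :> R.
  apply: le_trans (_ : expR (- (#|B|%:R / 2 ^+ n)) ^+ (2 ^ k) <= _).
    by rewrite lerXn2r ?nnegrE ?expR_ge0 ?subr_ge0 // expR_ge1Dx.
  rewrite -!expRM_natl ler_expR mulrN mulrN1 lerN2 mulrA ler_pdivlMr //.
  by rewrite -!natrX -!natrM ler_nat mulnC [(2 ^ k * _)%N]mulnC mulnC.
move/(le_trans N_le); rewrite expRN exprVn lef_pV2 ?posrE ?exprn_gt0 ?expR_gt0 //.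
rewrite leNgt ltrXn2r ?nnegrE ?expR_ge0 ?gtn_eqF //.
exact: expR_gt1Dx.
Qed.
End Covering.

(** Any word of syndrome [s] can be moved into [B] by a codeword of a covering code with n - m
    generators, without changing its syndrome. *)
Lemma exists_parity_check (R : realType) (n m : nat) (B : {set 'rV['F_2]_n}) :
  (0 < n)%N -> (n * 2 ^ m <= #|B|)%N ->
  exists H : 'M['F_2]_(n, m), forall s : 'rV['F_2]_m, exists2 x, x \in B & x *m H = s.
Proof.
move=> n_gt0 le_nB.
have le_mn : (m <= n)%N.
  rewrite -(@leq_exp2l 2) //.
  apply: leq_trans (_ : #|{: 'rV['F_2]_n}| <= _)%N; last by rewrite card_rVF2.
  by apply: leq_trans (max_card _); apply: leq_trans le_nB; rewrite leq_pmull.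
have [] := exists_covering_code n B R (n - m) n_gt0.
  by rewrite -{2}(subnKC le_mn) expnD mulnA leq_mul2r le_nB orbT.
move=> G covG; pose K := row_base (kermx G^T).
have GK0 : G *m K^T = 0.
  apply: trmx_inj; rewrite trmx_mul trmxK trmx0; apply/sub_kermxP.
  by rewrite eq_row_base.
have K_full : row_full K^T.
  by have := row_base_free (kermx G^T); rewrite /row_free /row_full mxrank_tr.
have le_mr : (m <= \rank (kermx G^T))%N.
  rewrite mxrank_ker mxrank_tr -[X in (X <= _)%N](subKn le_mn).
  by rewrite leq_sub2l // rank_leq_row.
(* The generators may be dependent, so the dual basis [K] may have more than [m] rows; [pid_mx]
   keeps [m] of the syndrome bits. *)
exists (K^T *m pid_mx m) => s.
have /submxP[z zE] : (s *m pid_mx m <= K^T)%MS by rewrite submx_full.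
have [u uB] := covG z; exists (z - u *m G) => //.
rewrite mulmxA mulmxBl -[u *m G *m _]mulmxA GK0 mulmx0 subr0 -zE -mulmxA.
by rewrite mul_pid_mx minnn (minn_idPr le_mr) pid_mx_1 mulmx1.
Qed.

(** * Converse *)

Lemma interference_pmfE (R : realType) (n : nat) (s : 'rV['F_2]_n) :
  interference_pmf R s = (2 ^+ n)^-1.
Proof.
rewrite /interference_pmf -exprVn -[X in _ ^+ X]card_ord -prodr_const.
apply: eq_bigr => i _; rewrite /bernoulli_pmf.
by case: eqP => // _; field.
Qed.

Lemma weight_wball (R : realType) (q : R) (n : nat) (x : 'rV['F_2]_n) :
  (wH x)%:R / n%:R <= q -> x \in wball q n.
Proof.
rewrite inE; case: n x => [|n] x.
  by rewrite mul0r (_ : wH _ = 0%N) //; apply/eqP; rewrite -leqn0 wH_le.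
by rewrite ler_pdivrMr // mulrC.
Qed.

(* The output y = f s + s + z determines s once f s is known, and f s lies in the
   ball. *)
Lemma sum_preimage_le (R : realType) (q : R) (n : nat)
    (f : 'rV['F_2]_n -> 'rV['F_2]_n) (z : 'rV['F_2]_n) (D : {set 'rV['F_2]_n}) :
  (forall s, f s \in wball q n) ->
  (\sum_s (f s + s + z \in D)%R <= #|wball q n| * #|D|)%N.
Proof.
move=> f_ball; rewrite -cardsX -big_mkcond sum1_card.
have g_inj : injective (fun s => (f s, f s + s + z)).
  by move=> s t [-> /addIr /addrI].
rewrite -(card_imset _ g_inj); apply: subset_leq_card.
apply/fintype.subsetP => _ /imsetP[s sD ->]; rewrite inE f_ball /=.
exact: sD.
Qed.

Section Converse.
Variables (R : realType) (q1 q2 : R) (n : nat) (C : Defs.code q1 q2 n).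

Definition dec_region w1 w2 : {set 'rV['F_2]_n} := [set y | dec C y == (w1, w2)].

Lemma sum_dec_region : (\sum_w1 \sum_w2 #|dec_region w1 w2| = 2 ^ n)%N.
Proof.
rewrite pair_big /= -card_rVF2 -sum1_card (partition_big (dec C) predT) //=.
apply: eq_bigr => -[w1 w2] _; rewrite -sum1_card.
by apply: eq_bigl => y; rewrite inE.
Qed.

(** All tuples (w1, w2, s1, s2) are equally likely, so integer counting can replace probabilities in
    the converse. *)
Definition nb_success : nat :=
  \sum_w1 \sum_w2 \sum_s1 \sum_s2
    (ddmac (enc1 w1 s1) (enc2 w2 s2) s1 s2 \in dec_region w1 w2).

(** For fixed messages and [s2], the sum over [s1] is at most the ball size times the size of the
    decoding region. These regions partition the output words, whence one factor 2^n; [s2] gives the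
    other. *)
Lemma nb_success_le1 : (nb_success <= 2 ^ n * (#|wball q1 n| * 2 ^ n))%N.
Proof.
rewrite -{2}sum_dec_region -card_rVF2 !big_distrr; apply: leq_sum => w1 _ /=.
rewrite !big_distrr; apply: leq_sum => w2 _ /=.
rewrite exchange_big -sum_nat_const; apply: leq_sum => s2 _.
apply: leq_trans (sum_preimage_le _ _ _ _ (enc2 w2 s2 + s2) (dec_region w1 w2)
  (fun s => weight_wball _ _ _ _ (enc1_weight w1 s))).
by apply: eq_leq; apply: eq_bigr => s1 _; rewrite /ddmac addrACA addrA addrAC.
Qed.

Lemma nb_success_le2 : (nb_success <= 2 ^ n * (#|wball q2 n| * 2 ^ n))%N.
Proof.
rewrite -{2}sum_dec_region -card_rVF2 !big_distrr; apply: leq_sum => w1 _ /=.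
rewrite !big_distrr; apply: leq_sum => w2 _ /=.
rewrite -sum_nat_const; apply: leq_sum => s1 _.
apply: leq_trans (sum_preimage_le _ _ _ _ (enc1 w1 s1 + s1) (dec_region w1 w2)
  (fun s => weight_wball _ _ _ _ (enc2_weight w2 s))).
by apply: eq_leq; apply: eq_bigr => s2 _; rewrite addrC addrACA addrA.
Qed.

Lemma success_probE :
  1 - error_prob C = nb_success%:R / (#|msg1 C|%:R * #|msg2 C|%:R * 2 ^+ n * 2 ^+ n).
Proof.
set c := _ * _ * _ * _.
have c_gt0 : 0 < c by rewrite !mulr_gt0 ?exprn_gt0 // ltr0n ?msg1_gt0 ?msg2_gt0.
suff : nb_success%:R / c + error_prob C = 1 by move=> /(canRL (addrK _)).
(* The total mass 1 is spread over all tuples, so that successes and errors recombine term by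
   term. *)
have sum_cV : \sum_(w1 : msg1 C) \sum_(w2 : msg2 C)
    \sum_(s1 : 'rV['F_2]_n) \sum_(s2 : 'rV['F_2]_n) c^-1 = 1.
  rewrite !sumr_const -!mulrnA card_rVF2 -[_ *+ _]mulr_natl !natrM !natrX.
  rewrite -[RHS](@divff _ c) ?gt_eqF // /c; congr (_ / _); ring.
rewrite -[RHS]sum_cV /nb_success /error_prob.
rewrite natr_sum mulr_suml -big_split; apply: eq_bigr => w1 _ /=.
rewrite natr_sum mulr_suml -big_split; apply: eq_bigr => w2 _ /=.
rewrite natr_sum mulr_suml -big_split; apply: eq_bigr => s1 _ /=.
rewrite natr_sum mulr_suml [X in _ + X]big_mkcond -big_split; apply: eq_bigr => s2 _ /=.
rewrite inE !interference_pmfE; case: (_ == _) => /=; first by rewrite mul1r addr0.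
by rewrite mul0r add0r /c !invfM.
Qed.

Lemma success_prob_le (B : nat) : (nb_success <= 2 ^ n * (B * 2 ^ n))%N ->
  #|msg1 C|%:R * #|msg2 C|%:R * (1 - error_prob C) <= B%:R.
Proof.
have N_gt0 : 0 < 2 ^+ n :> R by rewrite exprn_gt0.
have M1_neq0 : #|msg1 C|%:R != 0 :> R by rewrite pnatr_eq0 -lt0n msg1_gt0.
have M2_neq0 : #|msg2 C|%:R != 0 :> R by rewrite pnatr_eq0 -lt0n msg2_gt0.
rewrite success_probE -(ler_nat R) !natrM !natrX => le_S.
rewrite [leLHS](_ : _ = nb_success%:R / (2 ^+ n * 2 ^+ n)); last first.
  by field; rewrite M1_neq0 M2_neq0 gt_eqF.
by rewrite ler_pdivrMr ?mulr_gt0 //; move: le_S; rewrite mulrCA mulrA.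
Qed.

(** An error of at most 1/2 costs a factor 2 in the number of message pairs, that is one bit, hence
    1/n in the rate. *)
Lemma sum_rate_le (q : R) : 0 <= q <= 2^-1 -> (0 < n)%N -> error_prob C <= 2^-1 ->
  #|msg1 C|%:R * #|msg2 C|%:R * (1 - error_prob C) <= #|wball q n|%:R ->
  rate1 C + rate2 C <= Hb q + n%:R^-1.
Proof.
move=> q_bnd n_gt0 err_le le_B.
have n0 : 0 < n%:R :> R by rewrite ltr0n.
have M1_gt0 : 0 < #|msg1 C|%:R :> R by rewrite ltr0n msg1_gt0.
have M2_gt0 : 0 < #|msg2 C|%:R :> R by rewrite ltr0n msg2_gt0.
have M_gt0 := mulr_gt0 M1_gt0 M2_gt0.
have M_le : #|msg1 C|%:R * #|msg2 C|%:R <= 2 * expR (n%:R * (ln 2 * Hb q)).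
  have := le_trans le_B (card_wball_le R q n q_bnd).
  have : #|msg1 C|%:R * #|msg2 C|%:R * 2^-1 <=
         #|msg1 C|%:R * #|msg2 C|%:R * (1 - error_prob C).
    by rewrite ler_wpM2l ?(ltW M_gt0) //; lra.
  by lra.
have : ln (#|msg1 C|%:R * #|msg2 C|%:R) <= ln 2 + n%:R * (ln 2 * Hb q).
  rewrite -[X in _ + X]expRK -lnM ?posrE ?expR_gt0 //.
  by rewrite ler_ln ?posrE ?mulr_gt0 ?expR_gt0.
rewrite lnM ?posrE // => ln_le; rewrite /rate1 /rate2 /log2.
have l2 := ln2_gt0 R.
rewrite -mulrDl -mulrDl ler_pdivrMr // ler_pdivrMr //.
apply: le_trans ln_le _; rewrite mulrDl mulVf ?gt_eqF //.
by lra.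
Qed.

End Converse.

(** * Achievability *)

Lemma log2_card_rVF2 (R : realType) (m : nat) :
  log2 #|{: 'rV['F_2]_m}|%:R = m%:R :> R.
Proof.
have l2 := ln2_gt0 R.
by rewrite card_rVF2 natrX /log2 lnXn // -[ln 2 *+ m]mulr_natl mulfK ?gt_eqF.
Qed.

(* User i shifts its interference into the coset of syndrome (w1, 0), resp.
   (0, w2), so that the syndrome of the output is (w1, w2). *)
Lemma exists_syndrome_code (R : realType) (q q1 q2 : R) (n a b : nat)
    (H : 'M['F_2]_(n, a + b)) :
  (0 < n)%N -> q <= q1 -> q <= q2 ->
  (forall s, exists2 x, x \in wball q n & x *m H = s) ->
  exists C : Defs.code q1 q2 n,
    [/\ rate1 C = a%:R / n%:R, rate2 C = b%:R / n%:R & error_prob C = 0].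
Proof.
move=> n_gt0 le_q1 le_q2 covH.
have /choice[g gP] : forall s, exists x, x \in wball q n /\ x *m H = s.
  by move=> s; have [x] := covH s; exists x.
have gH s : g s *m H = s by have [] := gP s.
have g_weight s : (wH (g s))%:R / n%:R <= q.
  by have [+ _] := gP s; rewrite inE ler_pdivrMr ?ltr0n // mulrC.
have card_gt0 m : (0 < #|{: 'rV['F_2]_m}|)%N by rewrite card_rVF2 expn_gt0.
pose e1 (w : 'rV['F_2]_a) (s : 'rV['F_2]_n) := g (row_mx w 0 - s *m H).
pose e2 (w : 'rV['F_2]_b) (s : 'rV['F_2]_n) := g (row_mx 0 w - s *m H).
pose d (y : 'rV['F_2]_n) := (lsubmx (y *m H), rsubmx (y *m H)).
exists (Code (card_gt0 a) (card_gt0 b) d (fun w s => le_trans (g_weight _) le_q1 :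
          (wH (e1 w s))%:R / n%:R <= q1)
         (fun w s => le_trans (g_weight _) le_q2 : (wH (e2 w s))%:R / n%:R <= q2)).
split; rewrite /rate1 /rate2 /= ?log2_card_rVF2 //.
rewrite /error_prob /=; apply: big1 => w1 _; apply: big1 => w2 _.
apply: big1 => s1 _; apply: big_pred0 => s2; apply: negbTE; rewrite negbK.
rewrite /d /ddmac -addrA addrACA mulmxDl !mulmxDl !gH !subrK.
by rewrite add_row_mx addr0 add0r row_mxKl row_mxKr.
Qed.

Lemma wball_large (R : realType) (q rho : R) : 0 < q -> q <= 2^-1 -> rho < Hb q ->
  exists N : nat, forall n m : nat, (N <= n)%N -> m%:R <= n%:R * rho ->
    (n * 2 ^ m <= #|wball q n|)%N.
Proof.
move=> q_gt0 q_le rho_lt; have l2 := ln2_gt0 R.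
(* As 2^(n Hb(q)) = e^(n d) 2^(n rho), the factor e^(n d) has to absorb the polynomial losses; e^x
   >= x^3 / 6 suffices. *)
pose d := ln 2 * (Hb q - rho).
have d_gt0 : 0 < d by rewrite mulr_gt0 // subr_gt0.
(* From n >= 24 / (q d^3) follows q (n d)^3 / 6 >= 4 n^2 >= 2 (n + 1) n. *)
pose A := 24 / (q * d ^+ 3).
exists (Num.truncn A).+1 => n m le_Nn m_le.
have n_gt0 : 1 <= n%:R :> R by rewrite ler1n (leq_trans _ le_Nn).
have A_le : A <= n%:R.
  by rewrite ltW // (lt_le_trans (truncnS_gt A)) // ler_nat.
have qd_gt0 : 0 < q * d ^+ 3 by rewrite mulr_gt0 ?exprn_gt0.
have exp_ge : (n%:R * d) ^+ 3 / 6 <= expR (n%:R * d).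
  have nd_ge0 : 0 <= n%:R * d by rewrite mulr_ge0 // ltW.
  have := expR_ge1Dxn 2 nd_ge0.
  by rewrite (_ : 3`!%:R = 6) //; lra.
have main : 2 * n.+1%:R * n%:R <= q * expR (n%:R * d).
  apply: le_trans (_ : q * ((n%:R * d) ^+ 3 / 6) <= _); last by rewrite ler_wpM2l // ltW.
  have : 24 <= n%:R * (q * d ^+ 3) by rewrite -ler_pdivrMr.
  have n2 : 0 <= n%:R ^+ 2 :> R by rewrite exprn_ge0.
  move/(ler_wpM2l n2) => h.
  rewrite -natr1.
  have : n%:R <= n%:R ^+ 2 :> R by rewrite expr2 ler_peMl // ler0n.
  by lra.
rewrite -(ler_nat R) natrM natrX.
have N_gt0 : 0 < 2 * n.+1%:R :> R by rewrite mulr_gt0.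
rewrite -(ler_pM2l N_gt0); apply: le_trans (card_wball_ge_gt0 R q n q_gt0 q_le).
have -> : n%:R * (ln 2 * Hb q) = n%:R * d + n%:R * rho * ln 2 by rewrite /d; ring.
rewrite expRD [leLHS]mulrA [leRHS]mulrA; apply: ler_pM => //.
rewrite -{1}(@lnK R 2) ?posrE // -expRM_natl ler_expR.
by rewrite ler_wpM2r // ltW.
Qed.

Lemma Hb0 (R : realType) : Hb (0 : R) = 0.
Proof. by rewrite /Hb /log2 oppr0 addr0 !mul0r ln1 mul0r mulr0 subrr. Qed.

(** The separate case rho = 0 takes in q = 0, where Hb(q) = 0: then m = 0 and the zero word has the
    only syndrome. *)
Lemma exists_parity_check_rate (R : realType) (q rho : R) :
  0 <= q <= 2^-1 -> 0 <= rho -> rho = 0 \/ rho < Hb q ->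
  exists2 N : nat, (0 < N)%N & forall n m : nat, (N <= n)%N -> m%:R <= n%:R * rho ->
    exists H : 'M['F_2]_(n, m),
      forall s, exists2 x, x \in wball q n & x *m H = s.
Proof.
move=> /andP[q_ge0 q_le] rho_ge0 [->|rho_lt].
  exists 1%N => // n m _; rewrite mulr0 lern0 => /eqP ->.
  exists 0 => s; exists 0; last by rewrite [RHS]thinmx0 mul0mx.
  rewrite inE (_ : wH 0 = 0%N) ?mulr_ge0 //.
  by apply: eq_card0 => i; rewrite !inE mxE eqxx.
have q_gt0 : 0 < q.
  rewrite lt_neqAle q_ge0 andbT; apply: contraTneq rho_lt => <-.
  by rewrite -leNgt Hb0.
have [N largeN] := wball_large R q rho q_gt0 q_le rho_lt.
exists N.+1 => // n m lt_Nn m_le.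
apply: (exists_parity_check R); first exact: leq_trans lt_Nn.
exact: largeN (ltnW lt_Nn) m_le.
Qed.

(** * Limits of rates and the capacity region *)

Local Open Scope classical_set_scope.

(** Truncation loses at most 1 / (k + N), which is at most [harmonic k] = 1 / (k + 1) since N >
    0. *)
Lemma cvg_rate (R : realType) (N : nat) (r : R) : (0 < N)%N -> 0 <= r ->
  (Num.truncn ((k + N)%N%:R * r))%:R / (k + N)%N%:R @[k --> \oo] --> r.
Proof.
move=> N_gt0 r_ge0.
apply: (@squeeze_cvgr _ _ _ _ (fun k => r - harmonic k) (cst r)); last 2 first.
- by rewrite -[X in _ --> X]subr0; apply: cvgB; [exact: cvg_cst | exact: cvg_harmonic].
- exact: cvg_cst.
apply: nearW => k.
have n_gt0 : 0 < (k + N)%N%:R :> R by rewrite ltr0n addn_gt0 N_gt0 orbT.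
have /andP[t_le t_gt] := truncn_itv (mulr_ge0 (ltW n_gt0) r_ge0).
rewrite ler_pdivlMr // ler_pdivrMr // [r * _]mulrC t_le andbT.
rewrite mulrBl [r * _]mulrC; rewrite -natr1 in t_gt.
have : 1 <= @harmonic R k * (k + N)%N%:R.
  by rewrite /harmonic /= mulrC ler_pdivlMr // mul1r ler_nat -addn1 leq_add2l.
by lra.
Qed.

Lemma achievable_lt (R : realType) (q q1 q2 r1 r2 : R) :
  0 <= q <= 2^-1 -> q <= q1 -> q <= q2 -> 0 <= r1 -> 0 <= r2 ->
  r1 + r2 = 0 \/ r1 + r2 < Hb q -> achievable q1 q2 (r1, r2).
Proof.
move=> q_bnd le_q1 le_q2 r1_ge0 r2_ge0 r_lt.
have r_ge0 := addr_ge0 r1_ge0 r2_ge0.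
have [N N_gt0 codeN] := exists_parity_check_rate R q (r1 + r2) q_bnd r_ge0 r_lt.
(* Block lengths start at [N], so that every code exists; truncating each rate separately keeps the
   total number of bits at most n (r1 + r2). *)
pose t k r := Num.truncn ((k + N)%N%:R * r : R).
have C k : {C : Defs.code q1 q2 (k + N) |
    [/\ rate1 C = (t k r1)%:R / (k + N)%N%:R,
        rate2 C = (t k r2)%:R / (k + N)%N%:R & error_prob C = 0]}.
  apply: cid; have [||H covH] := codeN (k + N)%N (t k r1 + t k r2)%N.
  - exact: leq_addl.
  - by rewrite natrD mulrDr lerD // truncn_le mulr_ge0.
  by apply: (exists_syndrome_code _ _ _ _ _ _ _ _ _ le_q1 le_q2 covH);
    rewrite addn_gt0 N_gt0 orbT.
split=> //=; exists (fun k => k + N)%N, (fun k => sval (C k)); split.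
- exact: cvg_addnr.
- rewrite (_ : (fun k => _) = fun k => (t k r1)%:R / (k + N)%N%:R); first exact: cvg_rate.
  by apply/funext => k; have [-> _ _] := svalP (C k).
- rewrite (_ : (fun k => _) = fun k => (t k r2)%:R / (k + N)%N%:R); first exact: cvg_rate.
  by apply/funext => k; have [_ -> _] := svalP (C k).
rewrite (_ : (fun k => _) = cst 0); first exact: cvg_cst.
by apply/funext => k; have [_ _ ->] := svalP (C k).
Qed.

(** The slack [e] absorbs the term 1/n of [sum_rate_le], and the error is eventually at most 1/2;
    the bound then passes to the limit in a closed half-line. *)
Lemma achievable_sum_le (R : realType) (q1 q2 : R) (r : R * R) :
  0 <= q1 <= 2^-1 -> 0 <= q2 <= 2^-1 -> achievable q1 q2 r ->
  r.1 + r.2 <= Num.min (Hb q1) (Hb q2).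
Proof.
move=> q1_bnd q2_bnd [_ _ [n [C [n_oo r1_lim r2_lim err_lim]]]].
apply/ler_addgt0Pr => e e_gt0.
have sum_lim : rate1 (C k) + rate2 (C k) @[k --> \oo] --> r.1 + r.2 by exact: cvgD.
apply: (closed_cvg _ (@closed_le R (Num.min (Hb q1) (Hb q2) + e)) _ _ sum_lim).
have n_large : \forall k \near \oo, ((Num.truncn e^-1).+1 <= n k)%N.
  by move/cvgnyPge : n_oo.
have err_small : \forall k \near \oo, error_prob (C k) <= 2^-1.
  by apply: (cvgr_le _ err_lim); rewrite invr_gt0.
near=> k.
have le_n : ((Num.truncn e^-1).+1 <= n k)%N by near: k.
have le_err : error_prob (C k) <= 2^-1 by near: k.
have n_gt0 : (0 < n k)%N by apply: leq_trans le_n.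
have n_e : (n k)%:R^-1 <= e.
  rewrite -[leRHS]invrK lef_pV2 ?posrE ?invr_gt0 ?ltr0n //.
  by rewrite ltW // (lt_le_trans (truncnS_gt _)) // ler_nat.
apply: le_trans (lerD (lexx _) n_e); rewrite -lerBlDr le_min !lerBlDr.
have le1 := success_prob_le _ _ _ _ _ _ (nb_success_le1 _ _ _ _ (C k)).
have le2 := success_prob_le _ _ _ _ _ _ (nb_success_le2 _ _ _ _ (C k)).
by rewrite !sum_rate_le.
Unshelve. all: by end_near.
Qed.

(** Extends the converse from achievable pairs to their closure. *)
Lemma closed_sum_le (R : realType) (h : R) :
  closed [set r : R * R | [/\ 0 <= r.1, 0 <= r.2 & r.1 + r.2 <= h]].
Proof.
have fst_cont : continuous (fun r : R * R => r.1) by move=> r; exact: cvg_fst.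
have snd_cont : continuous (fun r : R * R => r.2) by move=> r; exact: cvg_snd.
have sum_cont : continuous (fun r : R * R => r.1 + r.2).
  by move=> r; apply: cvgD; [exact: fst_cont | exact: snd_cont].
rewrite (_ : [set r | _] = (fun r => r.1) @^-1` [set x | 0 <= x] `&`
    (fun r => r.2) @^-1` [set x | 0 <= x] `&`
    (fun r => r.1 + r.2) @^-1` [set x | x <= h]).
  by apply: closedI; [apply: closedI|]; apply: closed_comp.
by apply/seteqP; split=> [r [? ? ?]|r [[? ?] ?]].
Qed.

Theorem theorem1 (R : realType) (q1 q2 : R)
    (hq1 : 0 <= q1 <= 2^-1) (hq2 : 0 <= q2 <= 2^-1) :
  capacity_region q1 q2 =
  [set r : R * R | [/\ 0 <= r.1, 0 <= r.2 &
                       r.1 + r.2 <= Num.min (Hb q1) (Hb q2)]].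
Proof.
apply/seteqP; split=> [|[r1 r2] [/= r1_ge0 r2_ge0 r_le]].
  rewrite [X in _ `<=` X](proj1 (closure_id _) (closed_sum_le _ _)).
  apply: closure_subset => r r_ach; case: (r_ach) => r1_ge0 r2_ge0 _.
  by split=> //; exact: achievable_sum_le.
pose q := Num.min q1 q2.
have q_bnd : 0 <= q <= 2^-1 by rewrite /q; case: (leP q1 q2).
(* [Hb q] is one of the two entropies, hence at least their minimum. *)
have Hb_q : Num.min (Hb q1) (Hb q2) <= Hb q.
  by rewrite ge_min /q; case: (leP q1 q2); rewrite lexx ?orbT.
move=> U U_r.
(* Scaling (r1, r2) by l k < 1 brings a positive sum rate strictly below Hb q. *)
pose l k : R := 1 - harmonic k.
have l_cvg : l k @[k --> \oo] --> (1 : R).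
  by rewrite -[X in _ --> X]subr0; apply: cvgB; [exact: cvg_cst | exact: cvg_harmonic].
have lr_cvg r : l k * r @[k --> \oo] --> r.
  by rewrite -[X in _ --> X]mul1r; apply: cvgM l_cvg (cvg_cst _).
have U_near : \forall k \near \oo, U (l k * r1, l k * r2).
  exact: (cvg_pair (lr_cvg r1) (lr_cvg r2) U_r).
have [k Uk] := filter_ex U_near.
have l_lt1 : l k < 1 by rewrite ltrBlDr ltrDl harmonic_gt0.
have l_ge0 : 0 <= l k.
  by rewrite subr_ge0 /harmonic invf_le1 // ler1n.
exists (l k * r1, l k * r2); split => //.
apply: (achievable_lt R q) => //; rewrite ?mulr_ge0 ?ge_min ?lexx ?orbT //.
rewrite -mulrDr; have [->|r_neq0] := eqVneq (r1 + r2) 0; first by left; rewrite mulr0.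
right; apply: lt_le_trans (le_trans r_le Hb_q).
by rewrite gtr_pMl // lt_neqAle eq_sym r_neq0 addr_ge0.
Qed.
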